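(* For sufficiently large absolute constants $A,K>0$, every $k\ge 2$, all sufficiently large $n$, and every $\Delta\ge 1$, the following holds. Let $H$ be an $n$-vertex $k$-uniform hypergraph of maximum degree at most $\Delta$, and set $$Q=\left\lceil A\,\Delta^{1/(k-1)}\right\rceil,\qquad \ell=\min\left\{Q,\left\lceil K\sqrt{\log n}\right\rceil\right\}.$$ If every vertex $v$ independently receives a uniformly random $\ell$-subset $L(v)\subseteq [Q]$, then $H$ is $L$-colorable with high probability.
   Context: A hypergraph $H=(V,E)$ is $k$-uniform if every edge is a set of exactly $k$ vertices ($E$ is a set, so there are no repeated edges). A proper coloring assigns a color to each vertex so that no edge is monochromatic. The degree of a vertex is the number of edges containing it. $[Q]=\{1,\dots,Q\}$. Given lists $L(v)$ of colors for $v\in V$, $H$ is $L$-colorable if it has a proper coloring $\chi$ with $\chi(v)\in L(v)$ for every $v\in V$. The constants $A$ and $K$ do not depend on $k$, $n$, $\Delta$ or $H$, and the threshold for ''sufficiently large $n$'' does not depend on $k$, so that the statement also applies when $k$ grows with $n$. ''With high probability'' means with probability at least $1-n^{-c}$ for some constant $c>0$, over the random lists. Logarithms are natural. *)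

(* Defs.v *)
From HB Require Import structures.
From mathcomp Require Import all_boot all_order all_algebra.
From mathcomp Require Import reals exp.

Set Implicit Arguments.
Unset Strict Implicit.
Unset Printing Implicit Defensive.

Import Order.TTheory GRing.Theory Num.Theory.

Local Open Scope ring_scope.

(* A hypergraph on V is its edge set, so repeated edges are excluded. *)
Definition uniform_hypergraph (V : finType) (k : nat) (H : {set {set V}}) : Prop :=
  forall e, e \in H -> #|e| = k.

Definition degree (V : finType) (H : {set {set V}}) (v : V) : nat :=
  #|[set e in H | v \in e]|.

Definition max_degree (V : finType) (H : {set {set V}}) : nat :=
  (\max_(v : V) degree H v)%N.

Definition monochromatic (V C : finType) (chi : {ffun V -> C}) (e : {set V}) : bool :=
  [exists c : C, forall v in e, chi v == c].

Definition proper_coloring (V C : finType) (H : {set {set V}})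
    (chi : {ffun V -> C}) : bool :=
  [forall e in H, ~~ monochromatic chi e].

Definition list_colorable (V C : finType) (H : {set {set V}})
    (L : {ffun V -> {set C}}) : bool :=
  [exists chi : {ffun V -> C},
    proper_coloring H chi && [forall v, chi v \in L v]].

Definition unif_subset_pmf (R : realType) (C : finType) (l : nat) (S : {set C}) : R :=
  if #|S| == l then ('C(#|C|, l)%:R)^-1 else 0.

(* The product form of the mass function encodes the independence of the lists. *)
Definition random_lists_pmf (R : realType) (V C : finType) (l : nat)
    (L : {ffun V -> {set C}}) : R :=
  \prod_(v : V) unif_subset_pmf R l (L v).

Definition random_lists_prob (R : realType) (V C : finType) (l : nat)
    (E : pred {ffun V -> {set C}}) : R :=
  \sum_(L | E L) random_lists_pmf R l L.

(* Num.ceil is integer-valued; the absolute value only casts it to nat, since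
   the arguments below are nonnegative (A, K > 0). *)
Definition palette_size (R : realType) (A : R) (k D : nat) : nat :=
  `|Num.ceil (A * D%:R `^ (1 / (k%:R - 1)))|%N.

Definition list_size (R : realType) (A K : R) (k D n : nat) : nat :=
  minn (palette_size A k D) `|Num.ceil (K * Num.sqrt (ln n%:R))|%N.

(* Main.v *)
Require Import Defs.
From HB Require Import structures.
From mathcomp Require Import all_boot all_order all_algebra.
From mathcomp Require Import reals sequences exp.
From mathcomp Require Import zify ring lra.

Set Implicit Arguments.
Unset Strict Implicit.
Unset Printing Implicit Defensive.

Import Order.TTheory GRing.Theory Num.Theory.

Local Open Scope ring_scope.

(** Write T = D^(1/(k-1)), so that Q >= A T, put t = 1/T, and let p = l/Q be the
    probability that a given color enters a given list.

    Regularization. High codegrees are an obstacle: if many edges contain a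
    common set U, then a single unlucky color on U spoils many edges at once.
    When the edges e properly containing some U have total weight
    sum_e t^(|e|-|U|) > 1, all edges containing U are replaced by the single edge
    U, which only makes the coloring problem harder. Since the weight sum_(e containing v) t^|e|
    never increases at any vertex, it stays at most D t^k = t, which is exactly
    what forbids U from shrinking to a singleton. The process ends
    ([spread_refinement]) with a hypergraph whose edges have sizes between 2 and
    k and in which the edges properly containing any nonempty U have total weight
    at most 1.

    Coloring from lists with small color degrees. For a vertex v and a color c let
    Y be the sum of beta^-|F| over the edges F + v such that c is in the lists of
    all vertices of F. If beta is l/4 and at least half of the colors of every
    list have Y <= 1/2, then a proper coloring exists. This is the counting
    substitute for the local lemma: one shows that the number of proper colorings
    of S is at least beta times that of S - v
    ([list_colorable_of_color_degree]).

    Tail of Y. For an independent p-random set of vertices holding c, Y has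
    expectation O(1/A), and it exceeds 1/2 with probability exp(-Omega(l)). The
    reason is an exploration: as long as a set W of vertices known to hold c has
    fewer than l/64 elements, the edges inside W contribute at most 1/4 to Y, so
    some other edge must lie in the color class; revealing it multiplies the
    probability, summed over the possible edges, by at most a constant below 1
    for each new vertex, by the spread condition.
    The outcome is recorded as a polynomial with nonnegative coefficients in the
    indicators of the events that c is in the list of u, which dominates the
    indicator of Y > 1/2 ([overload_certificate]).

    Lists of fixed size. A set of r colors lies in a random l-subset of the
    palette with probability at most p^r, so the expectation of a product over
    all colors of such polynomials is at most what full independence would give
    ([random_lists_posynomial_le]). Hence the event that half of the l colors of
    v are overloaded has probability exp(-Omega(l^2)), which for
    l >= K sqrt(log n) is far below 1/n^2; a union bound over v concludes
    ([non_colorable_prob_le]). When l = Q all lists are the whole palette and the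
    color degrees are small with certainty ([full_lists_colorable]). *)

(** * Counting colorings from lists with small color degrees *)

Lemma ler_sum_sub (R : numDomainType) (I : finType) (P Q : pred I) (F G : I -> R) :
  (forall i, P i -> Q i /\ F i <= G i) -> (forall i, Q i -> 0 <= G i) ->
  \sum_(i | P i) F i <= \sum_(i | Q i) G i.
Proof.
move=> PQ G0; rewrite big_mkcond [leRHS]big_mkcond; apply: ler_sum => i _.
case: ifP => [/PQ[-> ]//|_]; case: ifP => // /G0; exact.
Qed.

Definition link (V : finType) (H : {set {set V}}) (v : V) : {set {set V}} :=
  [set F : {set V} | (v \notin F) && (v |: F \in H)].

Definition color_set (V C : finType) (L : V -> {set C}) (c : C) : {set V} :=
  [set u | c \in L u].

(** The proper colorings of the subhypergraph induced on [S]; the default color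
    [c0] outside [S] makes such a coloring a total function. *)
Definition partial_colorings (V C : finType) (H : {set {set V}})
    (L : V -> {set C}) (c0 : C) (S : {set V}) : {set {ffun V -> C}} :=
  [set f : {ffun V -> C} | [forall u, f u \in if u \in S then L u else [set c0]] &&
           [forall (e | (e \in H) && (e \subset S)), ~~ monochromatic f e]].

Lemma partial_coloringsE (V C : finType) (H : {set {set V}})
    (L : V -> {set C}) (c0 : C) (S : {set V}) (f : {ffun V -> C}) :
  (f \in partial_colorings H L c0 S) =
  [forall u, f u \in if u \in S then L u else [set c0]] &&
  [forall (e | (e \in H) && (e \subset S)), ~~ monochromatic f e].
Proof. exact: in_set. Qed.

Lemma leq_card_bigcup (I T : finType) (P : pred I) (B : I -> {set T}) :
  (#|\bigcup_(i | P i) B i| <= \sum_(i | P i) #|B i|)%N.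
Proof.
elim/big_rec2: _ => [|i n A _ IH]; first by rewrite cards0.
by apply: leq_trans (leq_card_setU _ _).1 _; rewrite leq_add2l.
Qed.

(** Giving [v] the color [c] extends a proper coloring of [S :\ v] unless some edge
    [v |: F] becomes monochromatic; then [c] is the color of all of [F], so the
    coloring is determined by its restriction to the complement of [F]. *)
Lemma extension_count (V C : finType) (H : {set {set V}}) (L : V -> {set C})
    (c0 : C) (S : {set V}) (v : V) (c : C) : v \in S -> c \in L v ->
  (#|partial_colorings H L c0 (S :\ v)| <=
   #|[set f in partial_colorings H L c0 S | f v == c]| +
   \sum_(F in link H v | (F \subset S :\ v) && (F \subset color_set L c))
      #|partial_colorings H L c0 ((S :\ v) :\: F)|)%N.
Proof.
move=> vS cLv; set PC := partial_colorings H L c0.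
pose upd (g : {ffun V -> C}) : {ffun V -> C} := [ffun u => if u == v then c else g u].
pose A := [set g in PC (S :\ v) | upd g \in PC S].
pose B (F : {set V}) := [set g in PC (S :\ v) | [forall u in F, g u == c]].
pose P F := [&& F \in link H v, F \subset S :\ v & F \subset color_set L c].
have AE g : (g \in A) = (g \in PC (S :\ v)) && (upd g \in PC S) by exact: in_set.
have BE F g : (g \in B F) = (g \in PC (S :\ v)) && [forall u in F, g u == c].
  exact: in_set.
have g_v g : g \in PC (S :\ v) -> g v = c0.
  by rewrite partial_coloringsE => /andP[/forallP/(_ v)]; rewrite !inE eqxx /= inE => /eqP.
(* A coloring either extends to S or has an edge through v colored c except at v. *)
have cover : PC (S :\ v) \subset A :|: \bigcup_(F | P F) B F.
  apply/subsetP => g gP; rewrite in_setU AE gP /=.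
  have [//|/=] := boolP (upd g \in PC S).
  move: (gP); rewrite !partial_coloringsE => /andP[/forallP gL /forall_inP gH].
  rewrite negb_and => /orP[/negP[]|].
    apply/forallP => u; have := gL u; rewrite ffunE !inE.
    by have [->|] := eqVneq u v; rewrite ?vS.
  rewrite negb_forall_in => /exists_inP[e /andP[eH eS]]; rewrite negbK => emono.
  case/existsP: (emono) => d /forall_inP ed.
  have ve : v \in e.
    apply: contraLR emono => nve; have eSv : e \subset S :\ v.
      by apply/subsetP => u ue; rewrite !inE (subsetP eS _ ue) andbT;
         apply: contraNneq nve => <-.
    apply: contra (gH e _); last by rewrite eH.
    case/existsP => d' /forall_inP ed'; apply/existsP; exists d'.
    apply/forall_inP => u ue; have := ed' u ue; rewrite ffunE.
    by case: (u =P v) ue => // ->; rewrite (negbTE nve).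
  have dc : d = c by have := ed v ve; rewrite ffunE eqxx => /eqP.
  have gc u : u \in e :\ v -> g u = c.
    by rewrite !inE => /andP[uv ue]; have := ed u ue;
       rewrite ffunE (negbTE uv) dc => /eqP.
  apply/bigcupP; exists (e :\ v).
    rewrite /P inE setD11 setD1K // eH setSD //=.
    apply/subsetP => u ue; rewrite inE -(gc u ue).
    have := gL u; move: ue; rewrite !inE => /andP[uv /(subsetP eS) ->].
    by rewrite uv.
  by rewrite BE gP; apply/forall_inP => u /gc ->.
apply: leq_trans (subset_leq_card cover) _.
apply: leq_trans (leq_card_setU _ _).1 _; apply: leq_add.
  have upd_inj : {in A &, injective upd}.
    move=> g h; rewrite !AE => /andP[gP _] /andP[hP _] /ffunP gh.
    apply/ffunP => u; have [->|uv] := eqVneq u v; first by rewrite !g_v.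
    by have := gh u; rewrite !ffunE (negbTE uv).
  rewrite -(card_in_imset upd_inj); apply/subset_leq_card/subsetP => f /imsetP[g].
  by rewrite AE => /andP[_ gP] ->; rewrite in_set gP /= ffunE; case: (v =P v).
apply: leq_trans (leq_card_bigcup _ _) _.
rewrite [leqRHS](eq_bigl P) //; apply: leq_sum => F /and3P[_ FS FL].
(* Colorings in B F are constant on F, so erasing F loses no information. *)
pose res (g : {ffun V -> C}) : {ffun V -> C} := [ffun u => if u \in F then c0 else g u].
have res_inj : {in B F &, injective res}.
  move=> g h; rewrite !BE => /andP[gP /forall_inP gF].
  move=> /andP[hP /forall_inP hF] /ffunP gh; apply/ffunP => u.
  have [uF|uF] := boolP (u \in F); first by rewrite (eqP (gF u uF)) (eqP (hF u uF)).
  by have := gh u; rewrite !ffunE (negbTE uF).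
rewrite -(card_in_imset res_inj); apply/subset_leq_card/subsetP => f /imsetP[g].
rewrite BE => /andP[]; rewrite partial_coloringsE.
move=> /andP[/forallP gL /forall_inP gH] _ ->; rewrite partial_coloringsE.
apply/andP; split.
  apply/forallP => u; have := gL u; rewrite ffunE !inE.
  by case: (u \in F) => //=; rewrite inE.
apply/forall_inP => e /andP[eH eS]; apply: contra (gH e _); last first.
  by rewrite eH (subset_trans eS) ?subsetDl.
case/existsP => d /forall_inP ed; apply/existsP; exists d; apply/forall_inP => u ue.
have := ed u ue; rewrite ffunE; have := subsetP eS u ue; rewrite !inE.
by case/andP => /negbTE ->.
Qed.

(** The number of proper colorings grows by a factor of at least [beta] with each
    new vertex. Inductively, deleting a set [F] from [S :\ v] divides the number of
    colorings by at least [beta ^+ #|F|], which bounds the loss caused in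
    [extension_count] by the edge [v |: F], and the hypothesis says that the
    total loss still leaves [beta] colors for [v]. *)
Lemma list_colorable_of_color_degree (R : realFieldType) (V C : finType)
    (H : {set {set V}}) (L : {ffun V -> {set C}}) (c0 : C) (beta : R) :
  0 < beta -> set0 \notin H ->
  (forall v, beta <= \sum_(c in L v)
     (1 - \sum_(F in link H v | F \subset color_set L c) beta ^- #|F|)) ->
  list_colorable H L.
Proof.
move=> beta_gt0 H0 degL; set PC := partial_colorings H L c0.
pose N S : R := #|PC S|%:R.
have N0 : N set0 = 1.
  rewrite /N (_ : PC set0 = [set [ffun => c0]]) ?cards1 //.
  apply/setP => f; rewrite partial_coloringsE inE; apply/andP/eqP => [[/forallP fL _]|->].
    by apply/ffunP => u; have := fL u; rewrite !inE ffunE => /eqP.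
  split; first by apply/forallP => u; rewrite !inE ffunE.
  apply/forall_inP => e /andP[eH]; rewrite subset0 => /eqP e0.
  by rewrite -e0 eH in H0.
have grow n : forall S F : {set V}, (#|S| <= n)%N -> F \subset S ->
    beta ^+ #|F| * N (S :\: F) <= N S.
  elim: n => [|n IH] S F.
    rewrite leqn0 cards_eq0 => /eqP ->; rewrite subset0 => /eqP ->.
    by rewrite cards0 setD0 mul1r.
  move=> Sn FS; have [->|/set0Pn[v vF]] := eqVneq F set0.
    by rewrite cards0 setD0 mul1r.
  have vS := subsetP FS v vF.
  have Svn : (#|S :\ v| <= n)%N by rewrite (cardsD1 v S) vS in Sn.
  have step : beta * N (S :\ v) <= N S.
    apply: le_trans (ler_wpM2r _ (degL v)) _; first exact: ler0n.
    have -> : N S = \sum_c #|[set f in PC S | f v == c]|%:R.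
      rewrite -natr_sum; congr (_%:R); rewrite -sum1_card.
      rewrite (partition_big (fun f : {ffun V -> C} => f v) xpredT) //=.
      by apply: eq_bigr => c _; rewrite sum1dep_card.
    rewrite mulr_suml [leRHS](bigID (mem (L v))) /= -[leLHS]addr0.
    apply: lerD; last by apply: sumr_ge0.
    apply: ler_sum => c cLv; rewrite mulrBl mul1r lerBlDr.
    have := extension_count H c0 vS cLv; rewrite -(ler_nat R) natrD natr_sum => ext.
    apply: le_trans ext _; rewrite lerD2l mulr_suml.
    rewrite [leRHS](bigID (fun F : {set V} => F \subset S :\ v)) /= -[leLHS]addr0.
    apply: lerD; last by apply: sumr_ge0 => G _; rewrite mulr_ge0 ?ler0n ?invr_ge0 ?exprn_ge0 ?ltW.
    rewrite [leRHS](eq_bigl (fun F : {set V} => (F \in link H v) &&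
      ((F \subset S :\ v) && (F \subset color_set L c)))); last first.
      by move=> G /=; rewrite -andbA [X in _ && X]andbC.
    apply: ler_sum => G /and3P[_ GS _].
    by rewrite mulrC ler_pdivlMr ?exprn_gt0 // mulrC; apply: IH.
  rewrite (cardsD1 v F) vF exprS -mulrA (le_trans _ step) // ler_pM2l //.
  have -> : S :\: F = (S :\ v) :\: (F :\ v).
    apply/setP => u; rewrite !inE; have [->|//] := eqVneq u v.
    by rewrite vF.
  by apply: IH => //; apply: setSD.
have : 0 < N setT.
  apply: lt_le_trans (grow #|V| setT setT _ _); rewrite ?subsetT ?cardsT //.
  by rewrite setDv N0 mulr1 exprn_gt0.
rewrite ltr0n card_gt0 => /set0Pn[f]; rewrite partial_coloringsE.
case/andP => /forallP fL /forall_inP fH; apply/existsP; exists f.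
apply/andP; split; last by apply/forallP => v; have := fL v; rewrite inE.
by apply/forall_inP => e eH; apply: fH; rewrite eH subsetT.
Qed.

(** * Removing high codegrees *)

Definition spread (R : realFieldType) (V : finType) (t : R) (H : {set {set V}}) : Prop :=
  forall U : {set V}, U != set0 ->
    \sum_(e in H | U \proper e) t ^+ (#|e| - #|U|) <= 1.

(** Collapsing the supersets of an overfull [U] to [U] itself removes at least two
    edges and adds one, so the process terminates. The degree bound is preserved
    because the removed edges weigh at least [t ^+ #|U|] at each vertex of [U]; it
    shows that no singleton is ever overfull, which keeps edges of size 1 out. *)
Lemma spread_refinement (R : realFieldType) (V : finType) (t : R) (H : {set {set V}}) :
  0 < t <= 1 -> (forall e, e \in H -> (2 <= #|e|)%N) ->
  (forall v, \sum_(e in H | v \in e) t ^+ #|e| <= t) ->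
  exists H' : {set {set V}},
    [/\ forall e, e \in H' -> (2 <= #|e|)%N,
        forall e, e \in H -> exists2 e', e' \in H' & e' \subset e &
        spread t H'].
Proof.
move=> /andP[t_gt0 t_le1]; have [n] := ubnP #|H|; elim: n => // n IH in H *.
rewrite ltnS => Hn H2 Hdeg.
pose excess (U : {set V}) := \sum_(e in H | U \proper e) t ^+ (#|e| - #|U|).
have [/forallP sprH|] := boolP [forall U, (U != set0) ==> (excess U <= 1)].
  exists H; split=> // [e eH|U U0]; first by exists e.
  exact: (implyP (sprH U) U0).
rewrite negb_forall => /existsP[U]; rewrite negb_imply -ltNge => /andP[U0 exU].
have t_ge0 : 0 <= t := ltW t_gt0.
have scale : excess U * t ^+ #|U| = \sum_(e in H | U \proper e) t ^+ #|e|.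
  rewrite mulr_suml; apply: eq_bigr => e /andP[_ /proper_card Ue].
  by rewrite -exprD subnK // ltnW.
have heavy : t ^+ #|U| < \sum_(e in H | U \proper e) t ^+ #|e|.
  by rewrite -scale -[ltLHS]mul1r ltr_pM2r // exprn_gt0.
have U2 : (2 <= #|U|)%N.
  rewrite ltnNge; apply: contraL heavy => U1; have /cards1P[v Uv] : #|U| == 1%N.
    by rewrite eqn_leq U1 card_gt0.
  rewrite Uv cards1 expr1 -leNgt; apply: le_trans (Hdeg v).
  apply: ler_sum_sub => [e /andP[-> Ue]|e _]; last by rewrite exprn_ge0.
  by rewrite -sub1set (proper_sub Ue).
pose H1 := U |: [set e in H | ~~ (U \subset e)].
have sz : (1 < #|[set e in H | U \proper e]|)%N.
  rewrite -(ltr_nat R); apply: lt_le_trans exU _.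
  rewrite -sum1dep_card natr_sum; apply: ler_sum => e _.
  by rewrite exprn_ile1.
case: (IH H1) => [|e|v|H' [H'2 H'H1 H'spr]].
- apply: leq_trans Hn; rewrite -(cardsID [set e : {set V} | U \subset e] H).
  apply: (@leq_trans (2 + #|[set e in H | ~~ (U \subset e)]|)).
    by rewrite ltnS (leq_trans (leq_card_setU _ _).1) // cards1.
  apply: leq_add.
    apply: leq_trans sz (subset_leq_card _); apply/subsetP => e.
    by rewrite !inE => /andP[-> /proper_sub].
  by apply: subset_leq_card; apply/subsetP => e; rewrite !inE => /andP[-> ->].
- by rewrite !inE => /predU1P[->//|/andP[/H2]].
- apply: le_trans (Hdeg v); rewrite (bigID (pred1 U)) /=.
  rewrite [leRHS](bigID (fun e : {set V} => U \proper e)) /=; apply: lerD.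
    have [vU|vU] := boolP (v \in U); last first.
      rewrite big1 => [|e /andP[/andP[_ ve] /eqP eU]].
        by apply: sumr_ge0 => e _; rewrite exprn_ge0.
      by rewrite eU (negbTE vU) in ve.
    rewrite (eq_bigl (pred1 U)) => [|e]; last first.
      by apply/andP/idP => [[]//|/eqP ->]; rewrite setU11 vU /=.
    rewrite big_pred1_eq; apply: le_trans (ltW heavy) _.
    apply: ler_sum_sub => [e /andP[-> Ue]|e _]; last by rewrite exprn_ge0.
    by rewrite Ue (subsetP (proper_sub Ue)).
  apply: ler_sum_sub => [e|e _]; last by rewrite exprn_ge0.
  rewrite !inE => /andP[/andP[/predU1P[->|/andP[eH Ue]] ve] eU].
    by rewrite eqxx in eU.
  by rewrite eH ve; split=> //; apply: contra Ue => /proper_sub.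
exists H'; split=> // e eH; have [Ue|Ue] := boolP (U \subset e).
  have [//|e' e'H' e'U] := H'H1 U; first by rewrite setU11.
  by exists e' => //; apply: subset_trans Ue.
by apply: H'H1; rewrite !inE eH Ue orbT.
Qed.

(** The case [U = v |: S] of the spread condition; for [S = set0] it bounds the
    weighted degree of [v]. *)
Lemma link_spread (R : realFieldType) (V : finType) (t : R) (H : {set {set V}}) :
  0 < t -> spread t H -> forall (v : V) (S : {set V}),
  \sum_(F in link H v | S \proper F) t ^+ (#|F| - #|S|) <= 1.
Proof.
move=> t_gt0 Hspr v S; have [vS|vS] := boolP (v \in S).
  rewrite big1 // => F /andP[]; rewrite inE => /andP[vF _] /proper_sub/subsetP/(_ v vS).
  by rewrite (negbTE vF).
have vS0 : v |: S != set0 by apply/set0Pn; exists v; rewrite setU11.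
apply: le_trans (Hspr _ vS0).
rewrite (reindex_onto (fun e => e :\ v) (fun F => v |: F)) => [|F]; last first.
  by rewrite inE => /andP[/andP[vF _] _]; rewrite setU1K.
apply: ler_sum_sub => [e|e _]; last by rewrite exprn_ge0 ?ltW.
rewrite inE => /andP[/andP[/andP[_ eH] Se] /eqP eE]; rewrite eE in eH; rewrite eH.
have ve : v \in e by rewrite -eE setU11.
split; last by rewrite cardsU1 vS (cardsD1 v e) ve subnDl.
rewrite -eE properE /=; apply/andP; split; first by rewrite setUS ?proper_sub.
apply: contra (proper_subn Se).
by move=> /(setSD [set v]); rewrite !setU1K ?setD11.
Qed.

Lemma sum_subsets_expr (R : comNzRingType) (V : finType) (b : R) (W : {set V}) :
  \sum_(S : {set V} | S \subset W) b ^+ #|S| = (1 + b) ^+ #|W|.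
Proof.
have := @bigA_distr R 0 1 *%R +%R V (fun i => if i \in W then b else 0) (fun=> 1 : R).
rewrite (bigID (mem W)) /= (eq_bigr (fun=> 1 + b)) => [|i /= ->]; last by rewrite addrC.
rewrite prodr_const big1 => [|i /negbTE /= ->]; last by rewrite add0r.
rewrite mulr1 => ->; rewrite [RHS](bigID (fun S : {set V} => S \subset W)) /=.
rewrite [X in _ + X]big1 => [|S /subsetPn[i iS iW]]; last first.
  by rewrite (bigD1 i) //= iS (negbTE iW) mul0r.
rewrite addr0; apply: eq_bigr => S SW; rewrite (bigID (mem S)) /=.
rewrite [X in _ * X]big1 => [|i /negbTE -> //]; rewrite mulr1 -prodr_const.
by apply: eq_bigr => i iS; rewrite iS (subsetP SW).
Qed.

(** * A certificate for large color degrees *)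

Lemma expr1DV_le (R : realType) (beta : R) (n : nat) :
  0 < beta -> 16 * n%:R <= beta -> (1 + beta^-1) ^+ n <= 5 / 4.
Proof.
move=> b0 nb; apply: (@le_trans _ _ (expR (n%:R * beta^-1))).
  rewrite expRM_natl; apply: lerXn2r; rewrite ?nnegrE ?expR_ge0 ?expR_ge1Dx //.
  by rewrite addr_ge0 ?invr_ge0 ?ltW.
have nb' : n%:R * beta^-1 <= 16^-1 by rewrite ler_pdivrMr // mulrC ler_pdivlMr; lra.
have e1 : expR (- 16^-1 : R) >= 15 / 16.
  by apply: le_trans (expR_ge1Dx _); lra.
apply: (@le_trans _ _ (expR (16^-1))); first by rewrite ler_expR.
rewrite -[16^-1]opprK expRN -[leRHS]invrK lef_pV2 ?posrE ?expR_gt0 ?invr_gt0; lra.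
Qed.

(** [X] is the set of vertices whose lists contain a fixed color, and [W] is the
    part of it already revealed. While [#|W| < m], the members of [FF] inside [W]
    account for at most 1/4 of the sum, so those not inside [W] contribute at
    least 1/4, and four times the weighted sum of the certificates for [W :|: F]
    is a certificate for [W]. Its cost is controlled by grouping the sets [F] by
    their trace on [W]: the spread condition pays for the new vertices of [F], each
    of which also brings a factor [expR 1] closer to the trivial cost at
    [#|W| = m]. The coefficients [a] are indexed by monomials, a monomial being
    the set of vertices that it requires to be in [X]. *)
Lemma overload_certificate (R : realType) (V : finType) (t beta p m : R)
    (FF : {set {set V}}) :
  0 < t -> 0 < beta -> 0 <= p -> 20 * (p * expR 1 / beta) <= t ->
  16 * m <= beta -> set0 \notin FF ->
  (forall S : {set V}, \sum_(F in FF | S \proper F) t ^+ (#|F| - #|S|) <= 1) ->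
  forall W : {set V}, exists a : {set V} -> R,
  [/\ forall W', 0 <= a W',
      forall X : {set V}, W \subset X ->
        1 / 2 < \sum_(F in FF | F \subset X) beta ^- #|F| ->
        1 <= \sum_(W' : {set V} | W' \subset X) a W' &
      \sum_W' a W' * p ^+ #|W'| <= p ^+ #|W| * expR (#|W|%:R - m)].
Proof.
move=> t0 b0 p0 pbt mb FF0 spr W; have [n] := ubnP #|~: W|.
elim: n => // n IH in W *; rewrite ltnS => Wn.
have [mW|Wm] := leP m #|W|%:R.
  exists (fun W' => (W' == W)%:R); split=> [W'|X WX _|].
  - exact: ler0n.
  - by rewrite (bigD1 W) //= eqxx lerDl sumr_ge0 // => S _; apply: ler0n.
  - rewrite (bigD1 W) //= eqxx big1 => [|S /negbTE ->]; last by rewrite mul0r.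
    by rewrite mul1r addr0 ler_peMr ?exprn_ge0 // -[leLHS]expR0 ler_expR subr_ge0.
have growth : (1 + beta^-1) ^+ #|W| <= 5 / 4 by apply: expr1DV_le => //; lra.
have binv0 k : 0 <= beta ^- k by rewrite invr_ge0 exprn_ge0 ?ltW.
(* The members of FF inside W are nonempty subsets of W. *)
have inside : \sum_(F in FF | F \subset W) beta ^- #|F| <= 1 / 4.
  suff : 1 + \sum_(F in FF | F \subset W) beta ^- #|F| <= 5 / 4 by lra.
  apply: le_trans growth; rewrite -sum_subsets_expr [leRHS](bigD1 set0) ?sub0set //=.
  rewrite cards0 expr0 lerD2l; apply: ler_sum_sub => [F /andP[FFF ->]|F _].
    by rewrite exprVn; split=> //=; apply: contraNneq FF0 => <-.
  by rewrite exprn_ge0 // invr_ge0 ltW.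
have /fin_all_exists[aF aFP] : forall F : {set V}, exists aF : {set V} -> R,
    F \in FF -> ~~ (F \subset W) ->
  [/\ forall W', 0 <= aF W',
      forall X : {set V}, (W :|: F) \subset X ->
        1 / 2 < \sum_(F in FF | F \subset X) beta ^- #|F| ->
        1 <= \sum_(W' : {set V} | W' \subset X) aF W' &
      \sum_W' aF W' * p ^+ #|W'| <= p ^+ #|W :|: F| * expR (#|W :|: F|%:R - m)].
  move=> F.
  have [FFF|_] := boolP (F \in FF); last by exists (fun=> 0).
  have [_|FW] := boolP (F \subset W); first by exists (fun=> 0).
  case: (IH (W :|: F)) => [|a aP]; last by exists a.
  apply: leq_trans Wn; apply: proper_card; rewrite setCU properE subsetIl /=.
  apply: contra FW => /subsetP WF; apply/subsetP => u uF.
  by apply: contraLR (uF) => uW; have := WF u; rewrite !inE uW => /(_ isT).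
pose a W' := 4 * \sum_(F in FF | ~~ (F \subset W)) beta ^- #|F| * aF F W'.
exists a; split=> [W'|X WX YX|].
- rewrite mulr_ge0 ?ler0n // sumr_ge0 // => F /andP[FFF FW].
  by rewrite mulr_ge0 //; case: (aFP F FFF FW).
- rewrite -mulr_sumr exchange_big /=.
  suff : 1 / 4 <= \sum_(F in FF | ~~ (F \subset W))
      \sum_(W' : {set V} | W' \subset X) beta ^- #|F| * aF F W' by lra.
  apply: (@le_trans _ _ (\sum_(F in FF | (F \subset X) && ~~ (F \subset W)) beta ^- #|F|)).
    move: YX; rewrite (bigID (fun F : {set V} => F \subset W)) /= => YX.
    have le1 : \sum_(F in FF | (F \subset X) && (F \subset W)) beta ^- #|F| <= 1 / 4.
      apply: le_trans inside; apply: ler_sum_sub => // F /and3P[-> _ ->]; by split.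
    have : forall x y z : R, 1/2 < x + y -> x <= 1/4 -> y = z -> 1/4 <= z by move=> *; lra.
    apply; [exact: YX | |by apply: eq_bigl => F; rewrite andbA].
    by rewrite (eq_bigl (fun F : {set V} => [&& F \in FF, F \subset X & F \subset W])) //
      => F; rewrite andbA.
  apply: ler_sum_sub => [F /and3P[FFF FX FW]|F /andP[FFF FW]]; last first.
    by apply: sumr_ge0 => W' _; rewrite mulr_ge0 //; case: (aFP F FFF FW).
  rewrite FFF FW; split=> //; rewrite -mulr_sumr ler_peMr //.
  by case: (aFP F FFF FW) => _ aX _; apply: aX; rewrite // subUset WX.
- rewrite (eq_bigr (fun W' => 4 * \sum_(F in FF | ~~ (F \subset W))
      beta ^- #|F| * (aF F W' * p ^+ #|W'|))) => [|W' _]; last first.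
    by rewrite /a -mulrA mulr_suml; congr (_ * _); apply: eq_bigr => F _; rewrite mulrA.
  rewrite -mulr_sumr exchange_big /=.
  set B := p ^+ #|W| * expR (#|W|%:R - m).
  have B0 : 0 <= B by rewrite mulr_ge0 ?exprn_ge0 ?expR_ge0.
  apply: (@le_trans _ _ (4 * \sum_(F in FF | ~~ (F \subset W))
     B * (beta ^- #|F :&: W| * (t ^+ (#|F| - #|F :&: W|) / 20)))).
    rewrite ler_pM2l ?ltr0n //; apply: ler_sum => F /andP[FFF FW].
    rewrite -mulr_sumr.
    case: (aFP F FFF FW) => _ _ /(ler_wpM2l (binv0 #|F|)) /le_trans; apply.
    have sz : (#|W :|: F| = #|W| + (#|F| - #|F :&: W|))%N.
      by rewrite cardsU setIC addnBA // subset_leq_card // subsetIl.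
    have lt0F : (0 < #|F| - #|F :&: W|)%N.
      rewrite subn_gt0 proper_card // properE subsetIl /=.
      by apply: contra FW; rewrite subsetI subxx.
    have FE : (#|F| = #|F :&: W| + (#|F| - #|F :&: W|))%N.
      by rewrite subnKC // subset_leq_card // subsetIl.
    rewrite sz {1}FE; move: (#|F| - #|F :&: W|)%N lt0F => j j0.
    have -> : beta ^- (#|F :&: W| + j) * (p ^+ (#|W| + j) * expR ((#|W| + j)%:R - m)) =
       B * (beta ^- #|F :&: W| * (p * expR 1 / beta) ^+ j).
      rewrite natrD -addrA [j%:R - m]addrC addrA expRD -[j%:R]mulr1 expRM_natl.
      rewrite !exprD invfM !exprMn exprVn /B; ring.
    apply: ler_wpM2l => //; apply: ler_wpM2l => //.
    (* As F is not inside W, j > 0, and one of the j factors provides the 1/20. *)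
    have q0 : 0 <= p * expR 1 / beta by rewrite divr_ge0 ?(ltW b0) ?mulr_ge0 ?expR_ge0.
    have qt : p * expR 1 / beta <= t / 20 by lra.
    case: j j0 => // j _; rewrite !exprSr -[_ / 20]mulrA ler_pM ?exprn_ge0 //.
    by apply: lerXn2r; rewrite ?nnegrE ?(ltW t0) //; lra.
  rewrite -mulr_sumr mulrCA ler_piMr //.
  (* Group the sets F by their trace S on W; the inner sums are at most 1/20. *)
  rewrite (partition_big (fun F => F :&: W) (fun S => S \subset W)) /=; last first.
    by move=> F _; apply: subsetIr.
  suff : \sum_(S : {set V} | S \subset W) 
       \sum_(F | (F \in FF) && ~~ (F \subset W) && (F :&: W == S))
       beta ^- #|F :&: W| * (t ^+ (#|F| - #|F :&: W|) / 20) <= 1 / 16 by lra.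
  apply: (@le_trans _ _ (\sum_(S : {set V} | S \subset W) beta^-1 ^+ #|S| / 20)).
    apply: ler_sum => S SW.
    apply: (@le_trans _ _ (beta^-1 ^+ #|S| / 20 *
        \sum_(F in FF | S \proper F) t ^+ (#|F| - #|S|))).
      rewrite mulr_sumr; apply: ler_sum_sub => [F /andP[/andP[-> FW] /eqP SE]|F _].
        split; last by rewrite SE exprVn; lra.
        by rewrite -SE properE subsetIl /= subsetI subxx.
      by rewrite !mulr_ge0 ?exprn_ge0 ?invr_ge0 ?ltW.
    by rewrite ler_piMr // ?divr_ge0 ?exprn_ge0 ?invr_ge0 ?ltW.
  rewrite -mulr_suml sum_subsets_expr; lra.
Qed.

(** * Lists of fixed size are negatively correlated *)

Lemma bin_sub_expn_le (Q l t : nat) : (l <= Q)%N -> (t <= Q)%N ->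
  ('C(Q - t, Q - l) * Q ^ t <= 'C(Q, Q - l) * l ^ t)%N.
Proof.
move=> lQ; elim: t => [|t IH] tQ; first by rewrite subn0 !expn0.
apply: (@leq_trans ('C(Q - t, Q - l) * l * Q ^ t)); last first.
  by rewrite mulnAC expnSr mulnA leq_mul2r IH ?orbT // ltnW.
rewrite expnS mulnA leq_mul2r; apply/orP; right.
have q0 : (0 < Q - t)%N by rewrite subn_gt0.
rewrite -(leq_pmul2l q0) !mulnA subnS mul_bin_down.
rewrite mulnAC [((Q - t) * _ * l)%N]mulnAC leq_mul2r; apply/orP; right.
by rewrite subnAC subKn // !mulnBl [(l * Q)%N]mulnC leq_sub2l // leq_mul2l lQ orbT.
Qed.

(** Complementation turns the [l]-sets containing [T] into the subsets of [~: T] of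
    size [#|C| - l], which are easier to count. *)
Lemma sum_pmf_superset (R : realType) (C : finType) (l : nat) (T : {set C}) :
  (l <= #|C|)%N ->
  \sum_(S : {set C} | T \subset S) unif_subset_pmf R l S =
  'C(#|C| - #|T|, #|C| - l)%:R / 'C(#|C|, l)%:R.
Proof.
move=> lC; rewrite /unif_subset_pmf -big_mkcondr sumr_const -[LHS]mulr_natl.
congr (_%:R * _); have <- : #|~: T| = (#|C| - #|T|)%N by rewrite cardsCs setCK.
rewrite -cards_draws -(card_imset _ (@setC_inj C)); apply: eq_card => A.
rewrite inE; apply/imsetP/andP => [[S]|[AT /eqP Al]].
  rewrite unfold_in /= => /andP[TS /eqP Sl] ->.
  by rewrite setCS TS cardsCs setCK Sl.
exists (~: A); rewrite ?setCK // unfold_in /= -setCS setCK AT.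
by rewrite cardsCs setCK Al subKn /= ?eqxx.
Qed.

Lemma sum_pmf_superset_le (R : realType) (C : finType) (l : nat) (T : {set C}) :
  (0 < #|C|)%N -> (l <= #|C|)%N ->
  \sum_(S : {set C} | T \subset S) unif_subset_pmf R l S <= (l%:R / #|C|%:R) ^+ #|T|.
Proof.
move=> C0 lC; rewrite sum_pmf_superset // expr_div_n.
rewrite ler_pdivrMr ?ltr0n ?bin_gt0 // mulrAC ler_pdivlMr ?exprn_gt0 ?ltr0n //.
rewrite -!natrX -!natrM ler_nat [X in (_ <= X)%N]mulnC -[in X in (_ <= X)%N]bin_sub //.
by rewrite bin_sub_expn_le // max_card.
Qed.

Lemma random_lists_pmf_ge0 (R : realType) (V C : finType) (l : nat)
  (L : {ffun V -> {set C}}) : 0 <= random_lists_pmf R l L.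
Proof.
by apply: prodr_ge0 => v _; rewrite /unif_subset_pmf; case: ifP; rewrite ?invr_ge0 ?ler0n.
Qed.

Lemma sum_random_lists_pmf (R : realType) (V C : finType) (l : nat) :
  (l <= #|C|)%N -> \sum_(L : {ffun V -> {set C}}) random_lists_pmf R l L = 1.
Proof.
move=> lC; rewrite /random_lists_pmf -(bigA_distr_bigA (fun _ S => unif_subset_pmf R l S)).
apply: big1 => v _; have := sum_pmf_superset R set0 lC.
rewrite cards0 subn0 bin_sub // divff ?pnatr_eq0 -?lt0n ?bin_gt0 // => <-.
by apply: eq_bigl => S; rewrite sub0set.
Qed.

(** Expanding the product over the colors gives monomials that ask the list of each
    [v] to contain a prescribed set of colors. The lists are independent, and a
    random [l]-set contains [r] given colors with probability at most
    [(l / #|C|) ^ r], so each monomial has at most the expectation that it would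
    have if all pairs of a vertex and a color were independent. *)
Lemma random_lists_posynomial_le (R : realType) (V C : finType) (l : nat)
    (a : {set V} -> R) :
  (0 < #|C|)%N -> (l <= #|C|)%N -> (forall W, 0 <= a W) ->
  \sum_(L : {ffun V -> {set C}}) random_lists_pmf R l L *
     \prod_(c : C) \sum_(W : {set V} | W \subset color_set L c) a W <=
  (\sum_W a W * (l%:R / #|C|%:R) ^+ #|W|) ^+ #|C|.
Proof.
move=> C0 lC a0; set p := l%:R / #|C|%:R.
have dist (L : {ffun V -> {set C}}) :
    \prod_(c : C) \sum_(W : {set V} | W \subset color_set L c) a W =
    \sum_(f : {ffun C -> {set V}}) (\prod_c a (f c)) *
      \prod_v ([set c | v \in f c] \subset L v)%:R.
  under eq_bigr do rewrite big_mkcond.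
  rewrite bigA_distr_bigA; apply: eq_bigr => f _.
  have [/forallP fL|] := boolP [forall v, [set c | v \in f c] \subset L v].
    rewrite [X in _ * X]big1 ?mulr1 => [|v _]; last by rewrite fL.
    apply: eq_bigr => c _; rewrite ifT //; apply/subsetP => v vf.
    by rewrite inE (subsetP (fL v)) // inE.
  rewrite negb_forall => /existsP[v vf].
  rewrite [X in _ * X](bigD1 v) //= (negbTE vf) mul0r mulr0.
  case/subsetPn: vf => c; rewrite inE => cf cL.
  rewrite (bigD1 c) //= ifF ?mul0r //; apply/negbTE/subsetPn.
  by exists v => //; rewrite inE.
under eq_bigr do rewrite dist mulr_sumr.
rewrite exchange_big /= -prodr_const bigA_distr_bigA; apply: ler_sum => f _.
under eq_bigr do rewrite mulrCA.
rewrite -mulr_sumr big_split /=; apply: ler_wpM2l; first exact: prodr_ge0.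
under eq_bigr do rewrite -big_split /=.
rewrite -(bigA_distr_bigA (fun v S =>
  unif_subset_pmf R l S * ([set c | v \in f c] \subset S)%:R)).
have -> : \prod_c p ^+ #|f c| = \prod_v p ^+ #|[set c | v \in f c]|.
  rewrite -!expr_sum; congr (_ ^+ _).
  under eq_bigr do rewrite -sum1_card big_mkcond.
  rewrite exchange_big; apply: eq_bigr => v _.
  by rewrite -sum1_card -big_mkcond; apply: eq_bigl => c; rewrite inE.
apply: ler_prod => v _; apply/andP; split.
  apply: sumr_ge0 => S _; rewrite mulr_ge0 ?ler0n // /unif_subset_pmf.
  by case: ifP; rewrite ?invr_ge0 ?ler0n.
apply: le_trans (sum_pmf_superset_le R _ C0 lC).
rewrite [leRHS]big_mkcond; apply: ler_sum => S _.
by case: ifP => _; rewrite ?mulr1 ?mulr0.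
Qed.

(** * Probability of failure *)

(** Markov's inequality for the product over the colors of [1 + delta^-1 * f], where
    [f] is the certificate polynomial: the product is at least [delta ^- s] when
    there are [s] bad colors, and its expectation is at most [(1 + p) ^ #|C|]
    with [p = l / #|C|], hence at most [expR l]. *)
Lemma many_bad_colors_prob (R : realType) (V C : finType) (l s : nat)
    (bad : pred {set V}) (a : {set V} -> R) (delta : R) :
  (0 < #|C|)%N -> (l <= #|C|)%N -> 0 < delta -> (forall W, 0 <= a W) ->
  (forall X : {set V}, bad X -> 1 <= \sum_(W : {set V} | W \subset X) a W) ->
  \sum_W a W * (l%:R / #|C|%:R) ^+ #|W| <= l%:R / #|C|%:R * delta ->
  random_lists_prob R l (fun L : {ffun V -> {set C}} =>
     (s <= #|[set c | bad (color_set L c)]|)%N) <= delta ^+ s * expR l%:R.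
Proof.
move=> C0 lC d0 a0 abad; set p := l%:R / #|C|%:R => acost.
have p0 : 0 <= p by rewrite divr_ge0 ?ler0n.
pose a2 (W : {set V}) := (W == set0)%:R + delta^-1 * a W.
have a2_ge0 W : 0 <= a2 W.
  by rewrite addr_ge0 ?ler0n // mulr_ge0 // invr_ge0 ltW.
have a2E (X : {set V}) : \sum_(W : {set V} | W \subset X) a2 W =
    1 + delta^-1 * \sum_(W : {set V} | W \subset X) a W.
  rewrite big_split -mulr_sumr /=; congr (_ + _).
  rewrite (bigD1 set0) ?sub0set //= eqxx big1 ?addr0 // => W /andP[_ /negbTE ->//].
have := random_lists_posynomial_le C0 lC a2_ge0; rewrite -/p => moment.
have cost : (\sum_W a2 W * p ^+ #|W|) ^+ #|C| <= expR l%:R.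
  have -> : l%:R = #|C|%:R * p :> R by rewrite mulrC divfK // pnatr_eq0 -lt0n.
  rewrite expRM_natl; apply: lerXn2r; rewrite ?nnegrE ?expR_ge0 //.
    by apply: sumr_ge0 => W _; rewrite mulr_ge0 ?exprn_ge0.
  apply: le_trans (expR_ge1Dx p); under eq_bigr do rewrite mulrDl -mulrA.
  rewrite big_split -mulr_sumr /=; apply: lerD.
    rewrite (bigD1 set0) //= eqxx cards0 expr0 mulr1 big1 ?addr0 // => W /negbTE ->.
    by rewrite mul0r.
  by rewrite mulrC ler_pdivrMr.
apply: le_trans (ler_wpM2l _ (le_trans moment cost)); last by rewrite exprn_ge0 ?ltW.
rewrite mulr_sumr; apply: ler_sum_sub => [L sL|L _]; last first.
  rewrite !mulr_ge0 ?exprn_ge0 ?random_lists_pmf_ge0 ?(ltW d0) //.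
  by apply: prodr_ge0 => c _; apply: sumr_ge0.
split=> //; rewrite mulrCA ler_peMr ?random_lists_pmf_ge0 //.
rewrite -ler_pdivrMl ?exprn_gt0 // mulr1 -exprVn.
set B := [set c | bad (color_set L c)] in sL.
apply: (@le_trans _ _ ((1 + delta^-1) ^+ #|B|)).
  apply: (@le_trans _ _ ((1 + delta^-1) ^+ s)).
    by apply: lerXn2r; rewrite ?nnegrE ?addr_ge0 ?invr_ge0 ?(ltW d0) // lerDr.
  by apply: ler_weXn2l; rewrite // lerDl invr_ge0 ltW.
rewrite [leRHS](bigID (mem B)) /= -prodr_const -[leLHS]mulr1; apply: ler_pM.
- by apply: prodr_ge0 => c _; rewrite addr_ge0 ?invr_ge0 ?ltW.
- by [].
- apply: ler_prod => c; rewrite inE => /abad ac.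
  rewrite addr_ge0 ?invr_ge0 ?(ltW d0) //= a2E lerD2l ler_peMr //.
  by rewrite invr_ge0 ltW.
have one : \prod_(c | c \notin B) (1 : R) = 1 by apply: big1.
rewrite -[leLHS]one.
apply: ler_prod => c _; rewrite ler01 a2E lerDl mulr_ge0 ?sumr_ge0 //.
by rewrite invr_ge0 ltW.
Qed.

(** [X] stands for the set of vertices whose lists contain a given color. *)
Definition overloaded (R : realFieldType) (V : finType) (H : {set {set V}}) (beta : R)
    (v : V) (X : {set V}) : bool :=
  (v \in X) && (1 / 2 < \sum_(F in link H v | F \subset X) beta ^- #|F|).

(** Each vertex keeps the colors that are not overloaded at it. Shrinking the
    lists only decreases color degrees, so each of the at least [l / 2] remaining
    colors contributes at least 1/2 to the sum in
    [list_colorable_of_color_degree]. *)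
Lemma colorable_of_few_overloaded (R : realFieldType) (V C : finType)
    (H : {set {set V}}) (L : {ffun V -> {set C}}) (l : nat) (c0 : C) :
  set0 \notin H -> (0 < l)%N -> (forall v, #|L v| = l) ->
  (forall v, #|[set c | overloaded H (l%:R / 4 : R) v (color_set L c)]| < uphalf l)%N ->
  list_colorable H L.
Proof.
move=> H0 l0 Ll few; set beta := (l%:R / 4 : R) in few.
have b0 : 0 < beta by rewrite divr_gt0 ?ltr0n.
pose G : {ffun V -> {set C}} :=
  [ffun v => [set c in L v | ~~ overloaded H beta v (color_set L c)]].
have GL v : G v \subset L v by apply/subsetP => c; rewrite ffunE inE => /andP[].
suff : list_colorable H G.
  case/existsP => chi /andP[chiH /forallP chiG]; apply/existsP; exists chi.
  by rewrite chiH; apply/forallP => v; apply: (subsetP (GL v)).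
apply: (list_colorable_of_color_degree c0 b0 H0) => v.
have Gsz : (l <= 2 * #|G v|)%N.
  have := few v; rewrite -(Ll v) -(cardsID (G v) (L v)) (setIidPr (GL v)).
  rewrite (_ : _ :\: _ = [set c | overloaded H beta v (color_set L c)]).
    set x := #|G v|; set y := #|_|; rewrite uphalf_half => yxy.
    have := odd_double_half (x + y); rewrite -muln2; lia.
  apply/setP => c; rewrite !inE ffunE !inE /overloaded inE.
  by case: (c \in L v); rewrite /= ?negbK ?andbT ?andbF.
apply: (@le_trans _ _ (\sum_(c in G v) (1 / 2))).
  rewrite sumr_const -mulr_natl /beta.
  by move: Gsz; rewrite -(ler_nat R) natrM; lra.
apply: ler_sum => c; rewrite ffunE !inE => /andP[cL].
rewrite /overloaded inE cL /= -leNgt => Y.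
suff : \sum_(F in link H v | F \subset color_set G c) beta ^- #|F| <= 1 / 2 by lra.
apply: le_trans Y; apply: ler_sum_sub => [F /andP[-> FG]|F _]; last first.
  by rewrite invr_ge0 exprn_ge0 ?ltW.
split=> //; apply: subset_trans FG _; apply/subsetP => u; rewrite !inE.
exact: (subsetP (GL u)).
Qed.

Lemma expR1_le3 (R : realType) : expR 1 <= 3 :> R.
Proof.
have -> : expR 1 = expR (- (8%:R * - 8^-1)) :> R by congr expR; lra.
rewrite expRN expRM_natl -[leRHS]invrK lef_pV2 ?posrE ?invr_gt0 ?exprn_gt0 ?expR_gt0 //.
apply: (@le_trans _ _ ((1 + - 8^-1) ^+ 8)); first by rewrite !exprS expr0; lra.
by apply: lerXn2r; rewrite ?nnegrE ?expR_ge0 ?expR_ge1Dx //; lra.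
Qed.

Lemma pmf_list_card (R : realType) (V C : finType) (l : nat)
    (L : {ffun V -> {set C}}) :
  random_lists_pmf R l L != 0 -> forall v, #|L v| = l.
Proof.
move=> L0 v; apply/eqP; apply: contraNT L0 => vl.
by rewrite /random_lists_pmf (bigD1 v) //= /unif_subset_pmf (negbTE vl) mul0r.
Qed.

(** Starting the exploration at [[set v]] accounts for the requirement that the
    overloaded color belong to the list of [v] itself; this brings the factor
    [l / #|C|] that makes the number of colors disappear from the bound. With
    [delta = expR (1 - l / 64)] and [s] at least [l / 2], the exponent
    [l + s * (1 - l / 64)] is at most [3 l / 2 - l ^ 2 / 128]. *)
Lemma non_colorable_prob_le (R : realType) (V C : finType) (H : {set {set V}})
    (l : nat) (t : R) :
  0 < t -> (64 <= l <= #|C|)%N -> 240 <= t * #|C|%:R -> set0 \notin H ->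
  (forall v, set0 \notin link H v) -> spread t H ->
  random_lists_prob R l (fun L : {ffun V -> {set C}} => ~~ list_colorable H L) <=
  #|V|%:R * expR (3 / 2 * l%:R - l%:R ^+ 2 / 128).
Proof.
move=> t0 /andP[l64 lC] tC H0 link0 Hspr.
have l0 : (0 < l)%N by apply: leq_trans l64.
have C0 : (0 < #|C|)%N by apply: leq_trans lC.
have CR0 : 0 < #|C|%:R :> R by rewrite ltr0n.
have lR : 64 <= l%:R :> R by rewrite (ler_nat R 64).
pose beta : R := l%:R / 4; pose p : R := l%:R / #|C|%:R; pose m : R := l%:R / 64.
have b0 : 0 < beta by rewrite /beta; lra.
have p0 : 0 <= p by rewrite divr_ge0 ?ler0n.
pose bad v (L : {ffun V -> {set C}}) :=
  [set c | overloaded H beta v (color_set L c)].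
have bad_prob v : random_lists_prob R l
    (fun L : {ffun V -> {set C}} => (uphalf l <= #|bad v L|)%N) <=
    expR (3 / 2 * l%:R - l%:R ^+ 2 / 128).
  have pbt : 20 * (p * expR 1 / beta) <= t.
    have -> : 20 * (p * expR 1 / beta) = 80 * expR 1 / #|C|%:R.
      by rewrite /p /beta; field; apply/andP; split; lra.
    rewrite ler_pdivrMr //; have := expR1_le3 R; lra.
  have mb : 16 * m <= beta by rewrite /m /beta; lra.
  have [a [a0 acover acost]] := overload_certificate t0 b0 p0 pbt mb (link0 v)
    (link_spread t0 Hspr v) [set v].
  rewrite cards1 expr1 in acost.
  have abad (X : {set V}) : overloaded H beta v X ->
      1 <= \sum_(W : {set V} | W \subset X) a W.
    by case/andP => vX; apply: acover; rewrite sub1set.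
  have := many_bad_colors_prob (uphalf l) C0 lC (expR_gt0 _) a0 abad acost.
  move=> /le_trans; apply; rewrite -expRM_natl -expRD ler_expR /m.
  have half : l%:R / 2 <= (uphalf l)%:R :> R.
    rewrite ler_pdivrMr ?ltr0n // -natrM ler_nat uphalf_half.
    have := odd_double_half l; rewrite -muln2; lia.
  nra.
apply: (@le_trans _ _ (\sum_v random_lists_prob R l
    (fun L : {ffun V -> {set C}} => (uphalf l <= #|bad v L|)%N))); last first.
  apply: le_trans (ler_sum _ (fun v _ => bad_prob v)) _.
  by rewrite sumr_const -[leLHS]mulr_natl.
rewrite /random_lists_prob; under [leRHS]eq_bigr do rewrite big_mkcond.
rewrite exchange_big /=; apply: ler_sum_sub => [L nL|L _]; last first.
  by apply: sumr_ge0 => v _; case: ifP; rewrite ?random_lists_pmf_ge0.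
split=> //; have [->|L0] := eqVneq (random_lists_pmf R l L) 0.
  by apply: sumr_ge0 => v _; case: ifP.
have [v bv] : exists v, (uphalf l <= #|bad v L|)%N.
  apply/existsP; apply: contraNT nL; rewrite negb_exists => /forallP few.
  have /card_gt0P[c0 _] := C0.
  apply: (colorable_of_few_overloaded c0 H0 l0 (pmf_list_card L0)) => v.
  by rewrite ltnNge; apply: few.
rewrite (bigD1 v) //= bv lerDl sumr_ge0 // => u _.
by case: ifP; rewrite ?random_lists_pmf_ge0.
Qed.

(** Even when every vertex holds the color, the color degree is at most 1/2: it is
    the weighted degree of [v] with [t] replaced by [beta^-1 <= t / 2]. *)
Lemma full_lists_colorable (R : realFieldType) (V C : finType) (H : {set {set V}})
    (t : R) (L : {ffun V -> {set C}}) :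
  0 < t -> 240 <= t * #|C|%:R -> set0 \notin H ->
  (forall v, set0 \notin link H v) -> spread t H ->
  (forall v, #|L v| = #|C|) -> list_colorable H L.
Proof.
move=> t0 tC H0 link0 Hspr Lfull.
have C0 : (0 < #|C|)%N.
  by rewrite lt0n; apply: contraTneq tC => ->; rewrite mulr0 -ltNge ltr0n.
have CR0 : 0 < #|C|%:R :> R by rewrite ltr0n.
have /card_gt0P[c0 _] := C0.
apply: (@colorable_of_few_overloaded R _ _ _ _ #|C| c0) => // v.
set beta : R := #|C|%:R / 4.
have binv : beta^-1 <= t / 2.
  rewrite /beta invf_div ler_pdivrMr //; lra.
have bpos : 0 < beta^-1 by rewrite invr_gt0 divr_gt0.
rewrite (_ : [set _ | _] = set0) ?cards0 ?uphalf_gt0 //.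
apply/setP => c; rewrite !inE; apply/negbTE; rewrite negb_and -leNgt; apply/orP; right.
apply: (@le_trans _ _ (1 / 2 * \sum_(F in link H v | set0 \proper F) t ^+ (#|F| - #|@set0 V|))).
  rewrite mulr_sumr; apply: ler_sum_sub => [F /andP[FH _]|F _]; last first.
    by rewrite mulr_ge0 ?exprn_ge0 ?ltW ?divr_gt0.
  have F0 : F != set0 by apply: contraNneq (link0 v) => <-.
  rewrite FH proper0 F0 cards0 subn0 -exprVn; split=> //.
  have : (0 < #|F|)%N by rewrite card_gt0.
  case: #|F| => // j _; apply: le_trans (lerXn2r j.+1 _ _ binv) _.
  - by rewrite nnegrE ltW.
  - by rewrite nnegrE; lra.
  rewrite expr_div_n mulrC ler_wpM2r ?exprn_ge0 ?(ltW t0) // div1r lef_pV2 ?posrE ?exprn_gt0 //.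
  by rewrite exprS ler_peMr // exprn_ege1 // ler1n.
have := link_spread t0 Hspr v set0; lra.
Qed.

Theorem theorem4 (R : realType) :
  exists A0 K0 : R, [/\ 0 < A0, 0 < K0 &
    forall A K : R, A0 <= A -> K0 <= K ->
    exists c : R, 0 < c /\
    exists n0 : nat,
    forall (k n D : nat), (2 <= k)%N -> (n0 <= n)%N -> (1 <= D)%N ->
    forall (V : finType) (H : {set {set V}}),
      #|V| = n -> uniform_hypergraph k H -> (max_degree H <= D)%N ->
      1 - n%:R `^ (- c) <=
        random_lists_prob R (list_size A K k D n)
          (fun L : {ffun V -> {set 'I_(palette_size A k D)}} =>
             list_colorable H L)].
Proof.
exists 240, 256; split=> [||A K A0 K0]; rewrite ?ltr0n //.
exists 1; split=> //; exists 3 => k n D k2 n3 D1 V H Vn Hk HD.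
set Q := palette_size A k D; pose C : finType := 'I_Q.
set u := ln (n%:R : R); set l := list_size A K k D n.
have cC : #|C| = Q by rewrite card_ord.
have nR : 3 <= n%:R :> R by rewrite (ler_nat R 3).
have n0 : 0 < n%:R :> R by lra.
have u1 : 1 <= u by rewrite -[leLHS]expRK ler_ln ?posrE ?expR_gt0 // (le_trans (expR1_le3 R)).
pose T : R := D%:R `^ (1 / (k%:R - 1)).
have DR : 1 <= D%:R :> R by rewrite ler1n.
have k1 : 0 < k%:R - 1 :> R by rewrite subr_gt0 ltr1n.
have T1 : 1 <= T.
  by rewrite /T -[leLHS](powRr0 (D%:R : R)) ler_powR // divr_ge0 ?ltW.
have TD : T ^+ k.-1 = D%:R.
  rewrite -powR_mulrn ?powR_ge0 // -powRrM -subn1 natrB 1?ltnW //.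
  by rewrite div1r mulVf ?gt_eqF // powRr1 // ler0n.
have QA : A * T <= Q%:R.
  rewrite /Q /palette_size -/T natr_absz ger0_norm ?ceil_ge //.
  by rewrite ceil_ge0 (@lt_le_trans _ _ 0) ?ltrN10 // mulr_ge0; lra.
pose t := T^-1.
have t0 : 0 < t by rewrite invr_gt0; lra.
have t1 : t <= 1 by rewrite invf_le1; lra.
have tQ : 240 <= t * Q%:R.
  by rewrite mulrC ler_pdivlMr; last lra; apply: le_trans QA; rewrite ler_wpM2r; lra.
have [||v|H' [H'2 cover Hspr]] := @spread_refinement R V t H.
- by rewrite t0 t1.
- by move=> e /Hk ->.
(* The weight at v is at most D * t ^+ k, which is t since D = t ^- (k-1). *)
- apply: (@le_trans _ _ (\sum_(e in H | v \in e) t ^+ k)).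
    by rewrite le_eqVlt; apply/orP; left; apply/eqP/eq_bigr => e /andP[/Hk -> _].
  have -> : \sum_(e in H | v \in e) t ^+ k = (degree H v)%:R * t ^+ k.
    rewrite mulr_natl /degree -sumr_const; apply: eq_bigl => e.
    by rewrite !inE.
  have dD : (degree H v <= D)%N.
    by apply: leq_trans HD; apply: (@leq_bigmax _ (degree H)).
  apply: (@le_trans _ _ (D%:R * t ^+ k)).
    by rewrite ler_wpM2r ?exprn_ge0 ?(ltW t0) // ler_nat.
  rewrite -TD -{2}(prednK (ltnW k2)) exprSr mulrA -exprMn divff ?expr1n ?mul1r //.
  by apply: lt0r_neq0; lra.
have H'0 : set0 \notin H' by apply/negP => /H'2; rewrite cards0.
have link0 v : set0 \notin link H' v.
  by apply/negP; rewrite inE setU0 => /andP[_ /H'2]; rewrite cards1.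
have refine (L : {ffun V -> {set C}}) : list_colorable H' L -> list_colorable H L.
  case/existsP => chi /andP[/forall_inP chiH' chiL]; apply/existsP; exists chi.
  rewrite chiL andbT; apply/forall_inP => e /cover[e' /chiH' + /subsetP e'e].
  apply: contra => /existsP[c /forall_inP ec]; apply/existsP; exists c.
  by apply/forall_inP => w /e'e; apply: ec.
have lQ : (l <= #|C|)%N by rewrite cC geq_minl.
have total : random_lists_prob R l (fun L : {ffun V -> {set C}} => list_colorable H L) +
    random_lists_prob R l (fun L : {ffun V -> {set C}} => ~~ list_colorable H L) = 1.
  by rewrite -(sum_random_lists_pmf R V lQ) [RHS](bigID (list_colorable H)).
rewrite lerBlDr -[leLHS]total lerD2l.
apply: (@le_trans _ _ (random_lists_prob R l
    (fun L : {ffun V -> {set C}} => ~~ list_colorable H' L))).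
  apply: ler_sum_sub => [L nL|L _]; last exact: random_lists_pmf_ge0.
  by split=> //; apply: contra nL; apply: refine.
(* If the palette is no larger than K sqrt (log n), the lists are not random. *)
have [lE|lQn] := eqVneq l Q.
  rewrite /random_lists_prob big1 ?powR_ge0 // => L nL; apply/eqP; apply: contraNT nL => L0.
  apply: (full_lists_colorable t0) => //; first by rewrite cC.
  by move=> v; rewrite (pmf_list_card L0) cC.
have lK : K * Num.sqrt u <= l%:R.
  have -> : l = `|Num.ceil (K * Num.sqrt u)|%N.
    by move: lQn; rewrite /l /list_size /minn -/Q; case: ifP; rewrite ?eqxx.
  rewrite natr_absz ger0_norm ?ceil_ge //.
  by rewrite ceil_ge0 (@lt_le_trans _ _ 0) ?ltrN10 // mulr_ge0 ?sqrtr_ge0; lra.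
have s1 : 1 <= Num.sqrt u by rewrite -sqrtr1 ler_sqrt; lra.
have s2 : Num.sqrt u ^+ 2 = u by rewrite sqr_sqrtr; lra.
have l256 : 256 * Num.sqrt u <= l%:R by nra.
have l64 : (64 <= l <= #|C|)%N by rewrite lQ andbT -(ler_nat R); lra.
apply: le_trans (non_colorable_prob_le t0 l64 _ H'0 link0 Hspr) _; first by rewrite cC.
have nE : n%:R = expR u :> R by rewrite lnK ?posrE.
rewrite Vn powR_inv1 ?ler0n // nE -expRD -expRN ler_expR.
(* It remains to see that 2 u + 3 l / 2 <= l ^ 2 / 128. As l >= 256 sqrt u >= 256,
   the square of l dominates both 256 l and 256 ^ 2 u. *)
have h1 : 256 * u <= l%:R * Num.sqrt u by rewrite -[X in _ * X <= _]s2 expr2 mulrA ler_wpM2r; lra.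
have h2 : 256 * (l%:R * Num.sqrt u) <= l%:R ^+ 2.
  by rewrite mulrCA expr2 ler_wpM2l ?ler0n.
have h3 : 256 * l%:R <= l%:R ^+ 2 :> R by rewrite expr2 ler_wpM2r ?ler0n //; lra.
move: h1 h2 h3; move: (l%:R * _) (l%:R ^+ 2) => x y; lra.
Qed.
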